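(* If $0<\mathrm{Ste}<1$, $\alpha\ge 0$ and $\mathrm{Bi}$ is large enough, there exists at least one solution to problem $(\mathrm{P}_{1h})$, which is given by $$T_{1h}(x,t)=t^{\alpha/2}\theta_\infty\left[A_{1h}\left(1-\frac{x}{s_{1h}(t)}\right)+B_{1h}\left(1-\frac{x}{s_{1h}(t)}\right)^2\right],\qquad s_{1h}(t)=2a\nu_{1h}\sqrt{t},$$ where the constants $A_{1h}$ and $B_{1h}$ are defined as functions of $\nu_{1h}$ by $$A_{1h}=\frac{6\,\mathrm{Ste}-2\,\mathrm{Ste}\,\nu_{1h}^2(\alpha+1)-\frac{3}{\mathrm{Bi}}2^{\alpha+1}\nu_{1h}^{\alpha+1}-3\cdot 2^{\alpha+1}\nu_{1h}^{\alpha+2}}{\mathrm{Ste}\left[\nu_{1h}^2(\alpha+1)+\frac{2}{\mathrm{Bi}}\nu_{1h}(\alpha+1)+3\right]},$$ $$B_{1h}=\frac{-3\,\mathrm{Ste}+3\,\mathrm{Ste}\,\nu_{1h}^2(\alpha+1)+\frac{3}{\mathrm{Bi}}2^{\alpha}\nu_{1h}^{\alpha+1}+3\cdot 2^{\alpha+1}\nu_{1h}^{\alpha+2}}{\mathrm{Ste}\left[\nu_{1h}^2(\alpha+1)+\frac{2}{\mathrm{Bi}}\nu_{1h}(\alpha+1)+3\right]},$$ and where $\nu_{1h}>0$ is a solution to the equation (in the unknown $z>0$) $$\begin{aligned}&-3\cdot 2^{2\alpha+1}(\alpha-2)z^{2\alpha+4}-3\,\frac{2^{2\alpha}}{\mathrm{Bi}}(5\alpha-7)z^{2\alpha+3}-3\cdot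 2^{2\alpha+1}\left(\frac{\alpha-2}{\mathrm{Bi}^2}+3\right)z^{2\alpha+2}-9\,\frac{2^{2\alpha}}{\mathrm{Bi}}z^{2\alpha+1}\\&-3\cdot 2^{\alpha}\mathrm{Ste}(\alpha-3)(\alpha+1)z^{\alpha+4}-3\,\frac{2^{\alpha+1}}{\mathrm{Bi}}\mathrm{Ste}(\alpha-1)(\alpha+1)z^{\alpha+3}-3\cdot 2^{\alpha+1}\mathrm{Ste}(\alpha+7)z^{\alpha+2}\\&+3\,\frac{2^{\alpha+1}}{\mathrm{Bi}}\mathrm{Ste}(\alpha-5)z^{\alpha+1}+9\cdot 2^{\alpha}\mathrm{Ste}\,z^{\alpha}+2\,\mathrm{Ste}^2(1+\alpha)^2z^4-12\,\mathrm{Ste}^2(\alpha+1)z^2+18\,\mathrm{Ste}^2=0.\end{aligned}$$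
   Context: Fix real parameters $k,\rho,c,\gamma,\theta_\infty,h>0$ and $\alpha\ge 0$; put $a=\sqrt{k/(\rho c)}$, and define the generalized Stefan number $\mathrm{Ste}=\dfrac{k\theta_\infty}{\gamma a^{\alpha+2}}$ and the Biot number $\mathrm{Bi}=\dfrac{ah}{k}$. ''$\mathrm{Bi}$ large enough'' means: for given $\mathrm{Ste}$ and $\alpha$ there is a threshold such that the assertion holds for all $\mathrm{Bi}$ above it. A candidate pair $(T,s)$ consists of a continuous function $s:[0,\infty)\to[0,\infty)$, positive and continuously differentiable on $(0,\infty)$, and a function with quadratic profile in space $$T(x,t)=t^{\alpha/2}\theta_\infty\left[A\left(1-\frac{x}{s(t)}\right)+B\left(1-\frac{x}{s(t)}\right)^2\right],\quad 0\le x\le s(t),\ t>0,$$ with real constants $A,B$. Problem $(\mathrm{P}_{1h})$ (classical heat balance integral method, Robin condition): find a candidate pair $(T,s)=(T_{1h},s_{1h})$ such that, for all $t>0$: (i) $\dfrac{d}{dt}\displaystyle\int_0^{s(t)}T(x,t)\,dx=-a^2\left[\dfrac{\gamma}{k}s(t)^{\alpha}\dot s(t)+\dfrac{\partial T}{\partial x}(0,t)\right]$; (ii) $k\dfrac{\partial T}{\partial x}(0,t)=\dfrac{h}{\sqrt t}\left[T(0,t)-\theta_\infty t^{\alpha/2}\right]$; (iii) $T(s(t),t)=0$; (iv) $\dfrac{k}{\gamma s(t)^{\alpha}}\left[\dfrac{\partial T}{\partial x}(s(t),t)\right]^2=a^2\dfrac{\partial^2T}{\partial x^2}(s(t),t)$;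 and (v) $s(0)=0$. *)

(* Defs.v *)
From Stdlib Require Import Reals.
From Coquelicot Require Import Coquelicot.
Open Scope R_scope.

(* Real exponents are written with [Rpower], which is the usual power only for
   a positive base; every base below is positive wherever it is used. *)

Definition diffusivity_sqrt (k rho c : R) : R := sqrt (k / (rho * c)).

Definition Stefan (k rho c gamma theta alpha : R) : R :=
  k * theta / (gamma * Rpower (diffusivity_sqrt k rho c) (alpha + 2)).

Definition Biot (k rho c h : R) : R := diffusivity_sqrt k rho c * h / k.

Definition quadratic_profile (theta alpha A B : R) (s : R -> R) (x t : R) : R :=
  Rpower t (alpha / 2) * theta * (A * (1 - x / s t) + B * (1 - x / s t) ^ 2).

(* Functions on [0, oo), and on {(x, t) | 0 <= x <= s t, 0 < t}, are total
   functions whose values outside these sets are left unconstrained. *)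
Definition candidate_pair (theta alpha : R) (T : R -> R -> R) (s : R -> R) : Prop :=
  (forall t, 0 <= t -> 0 <= s t) /\
  continuous_on (fun t => 0 <= t) s /\
  (forall t, 0 < t -> 0 < s t /\ ex_derive s t /\ continuous (Derive s) t) /\
  (exists A B : R, forall x t, 0 < t -> 0 <= x <= s t ->
     T x t = quadratic_profile theta alpha A B s x t).

(* [Tx] and [Txx] are the first and second space derivatives of [T] at time [t],
   taken within [0, s t], hence one-sided at both end points. *)
Definition P1h (k rho c gamma theta h alpha : R)
    (T : R -> R -> R) (s : R -> R) : Prop :=
  let a := diffusivity_sqrt k rho c in
  candidate_pair theta alpha T s /\
  (forall t, 0 < t ->
     let D := fun x => 0 <= x <= s t in
     exists Tx Txx : R -> R,
       (forall x, D x -> D_in (fun y => T y t) Tx D x) /\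
       (forall x, D x -> D_in Tx Txx D x) /\
       is_derive (fun u => RInt (fun x => T x u) 0 (s u)) t
         (- a ^ 2 * (gamma / k * Rpower (s t) alpha * Derive s t + Tx 0)) /\
       k * Tx 0 = h / sqrt t * (T 0 t - theta * Rpower t (alpha / 2)) /\
       T (s t) t = 0 /\
       k / (gamma * Rpower (s t) alpha) * Tx (s t) ^ 2 = a ^ 2 * Txx (s t)) /\
  s 0 = 0.

Definition AB_denom (Ste Bi alpha nu : R) : R :=
  Ste * (nu ^ 2 * (alpha + 1) + 2 / Bi * nu * (alpha + 1) + 3).

Definition A1h (Ste Bi alpha nu : R) : R :=
  (6 * Ste - 2 * Ste * nu ^ 2 * (alpha + 1)
   - 3 / Bi * Rpower 2 (alpha + 1) * Rpower nu (alpha + 1)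
   - 3 * Rpower 2 (alpha + 1) * Rpower nu (alpha + 2))
  / AB_denom Ste Bi alpha nu.

Definition B1h (Ste Bi alpha nu : R) : R :=
  (- 3 * Ste + 3 * Ste * nu ^ 2 * (alpha + 1)
   + 3 / Bi * Rpower 2 alpha * Rpower nu (alpha + 1)
   + 3 * Rpower 2 (alpha + 1) * Rpower nu (alpha + 2))
  / AB_denom Ste Bi alpha nu.

Definition s1h (a nu t : R) : R := 2 * a * nu * sqrt t.

Definition T1h (theta alpha Ste Bi a nu : R) : R -> R -> R :=
  quadratic_profile theta alpha (A1h Ste Bi alpha nu) (B1h Ste Bi alpha nu)
    (s1h a nu).

Definition nu_equation (Ste Bi alpha z : R) : Prop :=
  - 3 * Rpower 2 (2 * alpha + 1) * (alpha - 2) * Rpower z (2 * alpha + 4)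
  - 3 * (Rpower 2 (2 * alpha) / Bi) * (5 * alpha - 7) * Rpower z (2 * alpha + 3)
  - 3 * Rpower 2 (2 * alpha + 1) * ((alpha - 2) / Bi ^ 2 + 3)
      * Rpower z (2 * alpha + 2)
  - 9 * (Rpower 2 (2 * alpha) / Bi) * Rpower z (2 * alpha + 1)
  - 3 * Rpower 2 alpha * Ste * (alpha - 3) * (alpha + 1) * Rpower z (alpha + 4)
  - 3 * (Rpower 2 (alpha + 1) / Bi) * Ste * (alpha - 1) * (alpha + 1)
      * Rpower z (alpha + 3)
  - 3 * Rpower 2 (alpha + 1) * Ste * (alpha + 7) * Rpower z (alpha + 2)
  + 3 * (Rpower 2 (alpha + 1) / Bi) * Ste * (alpha - 5) * Rpower z (alpha + 1)
  + 9 * Rpower 2 alpha * Ste * Rpower z alpha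
  + 2 * Ste ^ 2 * (1 + alpha) ^ 2 * z ^ 4
  - 12 * Ste ^ 2 * (alpha + 1) * z ^ 2
  + 18 * Ste ^ 2 = 0.

(* Main.v *)
(** With s(t) = 2 a nu sqrt t every condition is homogeneous in t, so the problem
    reduces to three algebraic equations for A, B, nu.  Writing
    P = (2 nu)^alpha, the heat balance (i) and the Robin condition (ii) are
    linear in (A, B) and give A1h, B1h; condition (iv) becomes
    Ste A^2 = 2 P B, which after clearing denominators is the equation for nu.

    Solvability: near 0 the numerator of B1h is negative, so Ste A^2 - 2 P B is
    positive there.  Because Ste < 1 the numerator of A1h changes sign before
    nu = 1, and at its zero that of B1h equals
    2 Ste (alpha + 1) nu^2 + 3 P nu^2 > 0, so Ste A^2 - 2 P B is negative. *)

Require Import Defs.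
From Stdlib Require Import Reals Lra Ranalysis5.
From Coquelicot Require Import Coquelicot.
Open Scope R_scope.

(** * Calculus of quadratic profiles in space *)

Lemma Rpower_plus_INR (x b : R) (n : nat) :
  0 < x -> Rpower x (b + INR n) = Rpower x b * x ^ n.
Proof. intros hx. rewrite Rpower_plus, Rpower_pow by exact hx. reflexivity. Qed.

(** The profile formula makes sense for every real x, so the one-sided derivatives at the end points
    required by [P1h] are restrictions of two-sided ones. *)
Lemma is_derive_D_in (f df : R -> R) (D : R -> Prop) (x : R) :
  is_derive f x (df x) -> D_in f df D x.
Proof.
  intros hf. apply (D_in_imp f df no_cond D); [intros; exact I|].
  apply derivable_pt_lim_D_in, is_derive_Reals, hf.
Qed.

Lemma is_derive_quadratic (C A B s x : R) :
  s <> 0 ->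
  is_derive (fun y => C * (A * (1 - y / s) + B * (1 - y / s) ^ 2)) x
    (C * (- A / s - 2 * B / s * (1 - x / s))).
Proof. intros hs. auto_derive; [easy | field; exact hs]. Qed.

Lemma is_derive_quadratic_slope (C A B s x : R) :
  s <> 0 ->
  is_derive (fun y => C * (- A / s - 2 * B / s * (1 - y / s))) x
    (C * (2 * B / s ^ 2)).
Proof. intros hs. auto_derive; [easy | field; exact hs]. Qed.

Lemma RInt_quadratic (C A B s : R) :
  s <> 0 ->
  RInt (fun x => C * (A * (1 - x / s) + B * (1 - x / s) ^ 2)) 0 s
  = C * s * (A / 2 + B / 3).
Proof.
  intros hs. apply is_RInt_unique.
  evar_last.
  (* Primitive in powers of 1 - x/s: it vanishes at x = s, so only the lower end contributes. *)
  - apply (is_RInt_derive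
      (fun x => - C * s * (A / 2 * (1 - x / s) ^ 2 + B / 3 * (1 - x / s) ^ 3))).
    + intros x _. auto_derive; [easy | field; exact hs].
    + intros x _. apply (ex_derive_continuous (V := R_NormedModule)).
      eexists. apply is_derive_quadratic. exact hs.
  - unfold minus, plus, opp; simpl. field. exact hs.
Qed.

(** * Time dependence of the front and of the heat content *)

Lemma is_derive_s1h (a nu t : R) :
  0 < t -> is_derive (s1h a nu) t (a * nu / sqrt t).
Proof.
  intros ht. unfold s1h. assert (hr := sqrt_lt_R0 t ht).
  auto_derive; [exact ht | field; lra].
Qed.

Lemma candidate_pair_quadratic (theta alpha A B a nu : R) :
  0 < a -> 0 < nu ->
  candidate_pair theta alpha
    (quadratic_profile theta alpha A B (s1h a nu)) (s1h a nu).
Proof.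
  intros ha hnu.
  assert (hanu : 0 < 2 * a * nu) by (apply Rmult_lt_0_compat; lra).
  split; [|split; [|split]].
  - intros t _. unfold s1h. apply Rmult_le_pos; [lra | apply sqrt_pos].
  - apply continuous_on_forall. intros t _.
    unfold s1h. apply (continuous_scal_r (V := R_NormedModule) (2 * a * nu)).
    apply continuous_sqrt.
  - intros t ht. assert (hr := sqrt_lt_R0 t ht). split; [|split].
    + apply Rmult_lt_0_compat; assumption.
    + eexists. apply is_derive_s1h, ht.
    + apply (continuous_ext_loc _ (fun u => a * nu / sqrt u)).
      (* The ball of radius t about t contains only positive times, where the derivative formula is
         valid. *)
      * exists (mkposreal t ht). intros u hu.
        symmetry. apply is_derive_unique, is_derive_s1h.
        apply Rabs_def2 in hu. unfold minus, plus, opp in hu; simpl in hu. lra.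
      * apply (ex_derive_continuous (V := R_NormedModule)).
        auto_derive. split; [exact ht | split; [lra | easy]].
  - exists A, B. reflexivity.
Qed.

Lemma heat_content (theta alpha A B a nu u : R) :
  0 < a -> 0 < nu -> 0 < u ->
  RInt (fun x => quadratic_profile theta alpha A B (s1h a nu) x u) 0 (s1h a nu u)
  = Rpower u (alpha / 2) * (theta * (A / 2 + B / 3)) * s1h a nu u :> R.
Proof.
  intros ha hnu hu. unfold quadratic_profile. rewrite RInt_quadratic; [ring|].
  unfold s1h. apply Rgt_not_eq.
  repeat apply Rmult_lt_0_compat; try lra. now apply sqrt_lt_R0.
Qed.

Lemma is_derive_heat_content (K alpha a nu t : R) :
  0 < t ->
  is_derive (fun u => Rpower u (alpha / 2) * K * s1h a nu u) t
    (a * nu * (alpha + 1) * K * Rpower t (alpha / 2) / sqrt t).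
Proof.
  intros ht. assert (hr := sqrt_lt_R0 t ht).
  unfold s1h, Rpower. auto_derive; [easy|].
  assert (ht2 := sqrt_sqrt t (Rlt_le _ _ ht)).
  (* With t replaced by r * r and its real power kept as an atom q, the goal is a rational
     identity. *)
  generalize dependent (sqrt t). generalize (exp (alpha / 2 * ln t)).
  intros q r hr <-. field. lra.
Qed.

(** Since sqrt t = t^(1/2), s^alpha carries the same factor t^(alpha/2) as the temperature, which
    lets t cancel from (i) and (iv). *)
Lemma Rpower_s1h (alpha a nu t : R) :
  0 < a -> 0 < nu -> 0 < t ->
  Rpower (s1h a nu t) alpha
  = Rpower (2 * nu) alpha * Rpower a alpha * Rpower t (alpha / 2).
Proof.
  intros ha hnu ht. unfold s1h.
  rewrite <- (Rpower_sqrt t ht).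
  replace (2 * a * nu) with (2 * nu * a) by ring.
  assert (0 < Rpower t (/ 2)) by apply exp_pos.
  assert (0 < 2 * nu * a) by (repeat apply Rmult_lt_0_compat; lra).
  rewrite <- !Rpower_mult_distr by lra.
  rewrite Rpower_mult. do 2 f_equal. field.
Qed.

(** * Reduction to algebraic equations for A, B and nu *)

(** The three equations are (i), (ii) and (iv) stripped of dimensional factors; (iii) and (v) follow
    from the shape of the pair. *)
Lemma P1h_of_coefficients (k rho c gamma theta h alpha nu A B : R) :
  let Ste := Stefan k rho c gamma theta alpha in
  let Bi := Biot k rho c h in
  let P := Rpower (2 * nu) alpha in
  0 < k -> 0 < rho -> 0 < c -> 0 < gamma -> 0 < theta -> 0 < h -> 0 < nu ->
  Ste * nu ^ 2 * (alpha + 1) * (3 * A + 2 * B)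
    = 3 * Ste * (A + 2 * B) - 6 * P * nu ^ 2 ->
  A + 2 * B = 2 * nu * Bi * (1 - A - B) ->
  Ste * A ^ 2 = 2 * P * B ->
  P1h k rho c gamma theta h alpha
    (quadratic_profile theta alpha A B (s1h (diffusivity_sqrt k rho c) nu))
    (s1h (diffusivity_sqrt k rho c) nu).
Proof.
  unfold Stefan, Biot, P1h; cbv zeta.
  set (a := diffusivity_sqrt k rho c).
  intros hk hrho hc hgamma htheta hh hnu hbal hrobin hfree.
  assert (ha : 0 < a).
  { apply sqrt_lt_R0, Rdiv_lt_0_compat; [exact hk | now apply Rmult_lt_0_compat]. }
  split; [|split].
  - now apply candidate_pair_quadratic.
  - intros t ht.
    assert (hs : 0 < s1h a nu t).
    { apply Rmult_lt_0_compat; [|now apply sqrt_lt_R0].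
      apply Rmult_lt_0_compat; lra. }
    assert (hq : 0 < Rpower t (alpha / 2)) by apply exp_pos.
    assert (hw : 0 < Rpower a alpha) by apply exp_pos.
    assert (hr := sqrt_lt_R0 t ht).
    change (alpha + 2) with (alpha + INR 2) in hbal, hfree.
    rewrite (Rpower_plus_INR a) in hbal, hfree by exact ha.
    assert (hP : 0 < Rpower (2 * nu) alpha) by apply exp_pos.
    exists (fun x => Rpower t (alpha / 2) * theta
      * (- A / s1h a nu t - 2 * B / s1h a nu t * (1 - x / s1h a nu t))).
    exists (fun _ => Rpower t (alpha / 2) * theta * (2 * B / s1h a nu t ^ 2)).
    split; [|split; [|split; [|split; [|split]]]].
    + intros x _. apply is_derive_D_in.
      apply is_derive_quadratic. lra.
    + intros x _. apply is_derive_D_in.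
      apply is_derive_quadratic_slope. lra.
    + apply (is_derive_ext_loc (fun u =>
        Rpower u (alpha / 2) * (theta * (A / 2 + B / 3)) * s1h a nu u)).
      * exists (mkposreal t ht). intros u hu.
        apply Rabs_def2 in hu. unfold minus, plus, opp in hu; simpl in hu.
        symmetry. apply heat_content; lra.
      * rewrite (is_derive_unique (s1h a nu) t _ (is_derive_s1h a nu t ht)).
        rewrite Rpower_s1h by assumption.
        evar_last; [now apply is_derive_heat_content|].
        unfold s1h.
        (* This factor clears 1 / sqrt t and the fractions 1/2 and 1/3 and completes k theta to the
           Stefan number, so that (i) becomes t^(alpha/2) times [hbal]. *)
        apply Rmult_eq_reg_r with (6 * nu * sqrt t * (k / (gamma * Rpower a alpha * a ^ 3))).
        2: { apply Rgt_not_eq, Rmult_lt_0_compat.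
             - repeat apply Rmult_lt_0_compat; lra.
             - apply Rdiv_lt_0_compat; [exact hk|].
               repeat apply Rmult_lt_0_compat; lra. }
        apply Rminus_diag_uniq.
        match type of hbal with ?l = ?r =>
          transitivity (Rpower t (alpha / 2) * (l - r)); [field; lra|] end.
        rewrite hbal. ring.
    + unfold quadratic_profile, s1h.
      apply Rminus_diag_uniq.
      (* The difference of the two sides of (ii) is an explicit multiple of that of [hrobin]; (iv)
         and [hfree] are related in the same way below. *)
      match type of hrobin with ?l = ?r =>
        transitivity (- (k * Rpower t (alpha / 2) * theta / (2 * a * nu * sqrt t)) * (l - r));
        [field; lra|] end.
      rewrite hrobin. ring.
    + unfold quadratic_profile. field. lra.
    + rewrite Rpower_s1h by assumption. unfold s1h.
      apply Rminus_diag_uniq.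
      match type of hfree with ?l = ?r =>
        transitivity (Rpower t (alpha / 2) * theta
          / (4 * nu ^ 2 * sqrt t ^ 2 * Rpower (2 * nu) alpha) * (l - r)); [field; lra|] end.
      rewrite hfree. ring.
  - unfold s1h. rewrite sqrt_0. ring.
Qed.

(** * Numerators of the coefficients and the equation for nu *)

(** Merging 2^alpha and z^alpha into (2 z)^alpha leaves a single factor that is not polynomial in z,
    easy to bound in the sign estimates. *)
Definition half_A_num (Ste Bi alpha z : R) : R :=
  3 * Ste - Ste * (alpha + 1) * z ^ 2
  - 3 * Rpower (2 * z) alpha * (z / Bi + z ^ 2).

Definition B_num (Ste Bi alpha z : R) : R :=
  3 * Ste * (alpha + 1) * z ^ 2 - 3 * Ste
  + 3 * Rpower (2 * z) alpha * (z / Bi + 2 * z ^ 2).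

(* [Ste * A1h ^ 2 - 2 * Rpower (2 * z) alpha * B1h], multiplied by
   [AB_denom ^ 2 / (2 * Ste)]. *)
Definition free_boundary_defect (Ste Bi alpha z : R) : R :=
  2 * half_A_num Ste Bi alpha z ^ 2
  - Rpower (2 * z) alpha * B_num Ste Bi alpha z
    * (z ^ 2 * (alpha + 1) + 2 / Bi * z * (alpha + 1) + 3).

Lemma A1h_half_A_num (Ste Bi alpha z : R) :
  0 < z ->
  A1h Ste Bi alpha z = 2 * half_A_num Ste Bi alpha z / AB_denom Ste Bi alpha z.
Proof.
  intros hz. unfold A1h, half_A_num. f_equal.
  change (alpha + 1) with (alpha + INR 1).
  change (alpha + 2) with (alpha + INR 2).
  rewrite <- Rpower_mult_distr, !Rpower_plus_INR by lra.
  simpl INR. unfold Rdiv. ring.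
Qed.

Lemma B1h_B_num (Ste Bi alpha z : R) :
  0 < z ->
  B1h Ste Bi alpha z = B_num Ste Bi alpha z / AB_denom Ste Bi alpha z.
Proof.
  intros hz. unfold B1h, B_num. f_equal.
  change (alpha + 1) with (alpha + INR 1).
  change (alpha + 2) with (alpha + INR 2).
  rewrite <- Rpower_mult_distr, !Rpower_plus_INR by lra.
  simpl INR. unfold Rdiv. ring.
Qed.

Lemma nu_equation_defect (Ste Bi alpha z : R) :
  0 < z -> nu_equation Ste Bi alpha z <-> free_boundary_defect Ste Bi alpha z = 0.
Proof.
  intros hz. unfold nu_equation, free_boundary_defect, half_A_num, B_num.
  (* With exponents written alpha + n or alpha + alpha + n, every power splits into copies of
     2^alpha or z^alpha and an integer power, so [ring] can compare the two sides. *)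
  replace (2 * alpha) with (alpha + alpha) by ring.
  replace (alpha + 1) with (alpha + INR 1) by (simpl; ring).
  replace (alpha + alpha + 1) with (alpha + alpha + INR 1) by (simpl; ring).
  replace (alpha + 2) with (alpha + INR 2) by (simpl; ring).
  replace (alpha + alpha + 2) with (alpha + alpha + INR 2) by (simpl; ring).
  replace (alpha + 3) with (alpha + INR 3) by (simpl; ring).
  replace (alpha + alpha + 3) with (alpha + alpha + INR 3) by (simpl; ring).
  replace (alpha + 4) with (alpha + INR 4) by (simpl; ring).
  replace (alpha + alpha + 4) with (alpha + alpha + INR 4) by (simpl; ring).
  rewrite <- Rpower_mult_distr, !Rpower_plus_INR, !Rpower_plus by lra.
  simpl INR. unfold Rdiv. rewrite <- pow_inv.
  match goal with |- ?l = 0 <-> ?r = 0 => replace l with r by ring end.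
  reflexivity.
Qed.

(** * Existence of a root by two intermediate value arguments *)

Lemma Rpower_le_1 (x b : R) : 0 < x <= 1 -> 0 <= b -> Rpower x b <= 1.
Proof.
  intros hx hb. apply Rle_trans with (Rpower 1 b); [now apply Rle_Rpower_l|].
  unfold Rpower. rewrite ln_1, Rmult_0_r, exp_0. lra.
Qed.

Lemma nu_equation_solvable (Ste Bi alpha : R) :
  0 < Ste < 1 -> 0 <= alpha -> 0 < Bi ->
  exists nu, 0 < nu /\ nu_equation Ste Bi alpha nu.
Proof.
  intros hSte halpha hBi.
  assert (hbeta : 0 < / Bi) by now apply Rinv_0_lt_compat.
  assert (hm : 0 <= Ste * (alpha + 1)) by nra.
  (* Chosen so that 3 z1, z1 / Bi and Ste (alpha + 1) z1 add up to Ste < 1. Hence z1 < 1/2, (2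
     z1)^alpha <= 1 and z1^2 < z1 / 2, and the constant terms 3 Ste and -3 Ste decide the signs of
     both numerators. *)
  set (z1 := Ste / (3 + / Bi + Ste * (alpha + 1))).
  assert (hz1 : z1 * (3 + / Bi + Ste * (alpha + 1)) = Ste) by (unfold z1; field; nra).
  assert (hz1pos : 0 < z1) by (apply Rdiv_lt_0_compat; lra).
  assert (hz1half : z1 < / 2) by nra.
  assert (hP1 : 0 < Rpower (2 * z1) alpha <= 1).
  { split; [apply exp_pos | apply Rpower_le_1; lra]. }
  assert (hP2 : 1 <= Rpower (2 * 1) alpha).
  { rewrite Rmult_1_r, <- (Rpower_O 2) by lra. apply Rle_Rpower; lra. }
  assert (hP1X : forall X, 0 <= X -> Rpower (2 * z1) alpha * X <= X) by (intros X hX; nra).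
  assert (hq : 0 < z1 ^ 2 < z1 / 2) by nra.
  assert (hzb : 0 < z1 * / Bi) by now apply Rmult_lt_0_compat.
  assert (hmz : 0 <= Ste * (alpha + 1) * z1 ^ 2 <= Ste * (alpha + 1) * z1 / 2) by nra.
  assert (hA1 : 0 < half_A_num Ste Bi alpha z1).
  { unfold half_A_num, Rdiv.
    assert (h := hP1X (z1 * / Bi + z1 ^ 2)). lra. }
  assert (hB1 : B_num Ste Bi alpha z1 < 0).
  { unfold B_num, Rdiv.
    assert (h := hP1X (z1 * / Bi + 2 * z1 ^ 2)). lra. }
  (* As 2^alpha >= 1, the value at 1 is below 3 Ste - 3 < 0. *)
  assert (hA2 : half_A_num Ste Bi alpha 1 < 0).
  { unfold half_A_num, Rdiv. nra. }
  (* [IVT_interv] expects a negative value at the left end, hence the sign change. *)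
  destruct (IVT_interv (fun z => - half_A_num Ste Bi alpha z) z1 1)
    as [z0 [hz0 hA0]]; try lra.
  { intros z hz. apply derivable_continuous_pt, ex_derive_Reals_0.
    unfold half_A_num, Rpower. auto_derive. lra. }
  assert (hz01 : z1 < z0) by (destruct hz0 as [[h | h] _]; [exact h | subst; lra]).
  assert (hP0 : 0 < Rpower (2 * z0) alpha) by apply exp_pos.
  assert (hd : forall z, 0 < z ->
    0 < z ^ 2 * (alpha + 1) + 2 / Bi * z * (alpha + 1) + 3).
  { intros z hz. unfold Rdiv.
    assert (0 < z * / Bi) by now apply Rmult_lt_0_compat.
    nra. }
  (* The sum [B_num] + [half_A_num] is identically 2 Ste (alpha + 1) z^2 + 3 (2 z)^alpha z^2. *)
  assert (hB0 : 0 < B_num Ste Bi alpha z0).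
  { assert (0 < Rpower (2 * z0) alpha * z0 ^ 2).
    { apply Rmult_lt_0_compat; [exact hP0 | apply pow_lt; lra]. }
    assert (0 <= Ste * (alpha + 1) * z0 ^ 2) by (apply Rmult_le_pos; [exact hm | apply pow2_ge_0]).
    unfold B_num, half_A_num in *. lra. }
  destruct (IVT_interv (fun z => - free_boundary_defect Ste Bi alpha z) z1 z0)
    as [nu [hnu hdef]]; try lra.
  - intros z hz. apply derivable_continuous_pt, ex_derive_Reals_0.
    unfold free_boundary_defect, half_A_num, B_num, Rpower. auto_derive. lra.
  - assert (hprod : 0 < Rpower (2 * z1) alpha * - B_num Ste Bi alpha z1
      * (z1 ^ 2 * (alpha + 1) + 2 / Bi * z1 * (alpha + 1) + 3)).
    { repeat apply Rmult_lt_0_compat; [lra | lra | now apply hd]. }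
    assert (0 < half_A_num Ste Bi alpha z1 ^ 2) by now apply pow_lt.
    unfold free_boundary_defect. lra.
  - assert (hprod : 0 < Rpower (2 * z0) alpha * B_num Ste Bi alpha z0
      * (z0 ^ 2 * (alpha + 1) + 2 / Bi * z0 * (alpha + 1) + 3)).
    { repeat apply Rmult_lt_0_compat; [lra | lra | apply hd; lra]. }
    unfold free_boundary_defect.
    replace (half_A_num Ste Bi alpha z0) with 0 by lra. lra.
  - exists nu. split; [lra|]. apply nu_equation_defect; lra.
Qed.

Theorem theorem4p1 (Ste alpha : R) (hSte : 0 < Ste < 1) (halpha : 0 <= alpha) :
  exists Bi0 : R,
  forall (k rho c gamma theta h : R),
    0 < k -> 0 < rho -> 0 < c -> 0 < gamma -> 0 < theta -> 0 < h ->
    Stefan k rho c gamma theta alpha = Ste ->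
    Bi0 < Biot k rho c h ->
    let a := diffusivity_sqrt k rho c in
    let Bi := Biot k rho c h in
    (exists nu : R, 0 < nu /\ nu_equation Ste Bi alpha nu) /\
    (forall nu : R, 0 < nu -> nu_equation Ste Bi alpha nu ->
       P1h k rho c gamma theta h alpha
         (T1h theta alpha Ste Bi a nu) (s1h a nu)).
Proof.
  (* Threshold 0 suffices: the sign argument works for every positive Biot number. *)
  exists 0. intros k rho c gamma theta h hk hrho hc hgamma htheta hh hStefan hBi a Bi.
  split; [now apply nu_equation_solvable|].
  intros nu hnu heq. apply nu_equation_defect in heq; [|exact hnu].
  unfold free_boundary_defect in heq. fold Bi in hBi.
  assert (hd : 0 < nu ^ 2 * (alpha + 1) + 2 * nu / Bi * (alpha + 1) + 3).
  { assert (0 < 2 * nu / Bi) by (apply Rdiv_lt_0_compat; lra). nra. }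
  (* The denominator multiplied by [Bi], in the form whose nonvanishing [field] asks for. *)
  assert (hd' : nu ^ 2 * (alpha + 1) * Bi + 2 * nu * (alpha + 1) + 3 * Bi <> 0).
  { apply Rgt_not_eq. apply (Rmult_lt_compat_r Bi) in hd; [|exact hBi].
    rewrite Rmult_0_l in hd. apply (Rlt_le_trans _ _ _ hd). right. field. lra. }
  apply P1h_of_coefficients; try assumption;
    rewrite ?hStefan; fold Bi; rewrite A1h_half_A_num, B1h_B_num by exact hnu.
  (* The coefficients solve the two linear equations for every nu > 0; the equation for nu enters in
     the third. *)
  - unfold half_A_num, B_num, AB_denom. field. repeat split; lra.
  - unfold half_A_num, B_num, AB_denom. field. repeat split; lra.
  - apply Rminus_diag_uniq. match type of heq with ?l = 0 =>
      transitivity (2 * l / (Ste * (nu ^ 2 * (alpha + 1) + 2 / Bi * nu * (alpha + 1) + 3) ^ 2))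
    end; [|rewrite heq; unfold Rdiv; ring].
    unfold AB_denom. field. repeat split; lra.
Qed.
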